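(* In the genus 1 case, the group $\mathcal{H}$ is of order $4$ if and only if $$\begin{vmatrix} p_{11}&p_{10}&p_{1,-1}\\ p_{01}&p_{00}-1&p_{0,-1}\\ p_{-1,1}&p_{-1,0}&p_{-1,-1}\end{vmatrix}=0,$$ and this is the only case where the matrix $$\mathbb{P}=\begin{pmatrix} p_{11}&p_{10}&p_{1,-1}\\ p_{01}&p_{00}-1&p_{0,-1}\\ p_{-1,1}&p_{-1,0}&p_{-1,-1}\end{pmatrix}$$ has rank $2$.
   Context: Let $p_{ij}\ge 0$, $-1\le i,j\le 1$, with $\sum_{i,j}p_{ij}=1$. Put $$Q(x,y)=xy\Big(1-\sum_{-1\le i,j\le 1}p_{ij}x^iy^j\Big).$$ Up to the sign of $Q$ (which is irrelevant, since only the curve $\{Q=0\}$ matters), $Q(x,y)=a(x)y^2+b(x)y+c(x)=\tilde a(y)x^2+\tilde b(y)x+\tilde c(y)$ with $a(x)=p_{1,1}x^2+p_{0,1}x+p_{-1,1}$, $b(x)=p_{1,0}x^2+(p_{0,0}-1)x+p_{-1,0}$, $c(x)=p_{1,-1}x^2+p_{0,-1}x+p_{-1,-1}$, $\tilde a(y)=p_{1,1}y^2+p_{1,0}y+p_{1,-1}$, $\tilde b(y)=p_{0,1}y^2+(p_{0,0}-1)y+p_{0,-1}$, $\tilde c(y)=p_{-1,1}y^2+p_{-1,0}y+p_{-1,-1}$. Standing assumption: $Q$ is irreducible of degree 2 in each variable and the algebraic curve $\{Q(x,y)=0\}$ has genus 1. Let $\mathbb{C}_Q(x,y)$ be the function field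 of this curve (the field of fractions of $\mathbb{C}[x,y]/(Q)$). Let $\xi,\eta$ be the $\mathbb{C}$-automorphisms of $\mathbb{C}_Q(x,y)$ determined by $\xi(x)=x$, $\xi(y)=\frac{c(x)}{y\,a(x)}$ and $\eta(y)=y$, $\eta(x)=\frac{\tilde c(y)}{x\,\tilde a(y)}$; they are involutions. The group of the random walk is $\mathcal{H}=\langle\xi,\eta\rangle$. *)

(* Defs.v *)
From mathcomp Require Import all_boot all_order all_algebra.
From mathcomp Require Import classical_sets boolp functions cardinality fsbigop reals.
From mathcomp Require Import complex.

Set Implicit Arguments.
Unset Strict Implicit.
Unset Printing Implicit Defensive.

Import Order.TTheory GRing.Theory Num.Theory.
Local Open Scope classical_set_scope.
Local Open Scope complex_scope.
Local Open Scope ring_scope.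

(* Ring-theoretic irreducibility.  On {poly {poly K}} this differs from the
   library's [irreducible_poly], which ignores factors from {poly K}. *)
Definition irreducible_elt (A : idomainType) (q : A) : Prop :=
  [/\ q != 0, q \isn't a GRing.unit &
      forall f g : A, q = f * g -> f \is a GRing.unit \/ g \is a GRing.unit].

(* [phi : K[x,y] -> F] exhibits F as the field of fractions of K[x,y]/(q):
   its kernel is (q), and every element of F is a quotient of elements of its
   image.  This determines (F, phi) up to a unique isomorphism. *)
Definition is_function_field (K F : fieldType) (q : {poly {poly K}})
    (phi : {rmorphism {poly {poly K}} -> F}) : Prop :=
  (forall f, phi f = 0 <-> exists g, f = g * q) /\
  (forall z : F, exists f g, phi g != 0 /\ z = phi f / phi g).

Definition const_of (K F : fieldType) (phi : {rmorphism {poly {poly K}} -> F})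
  (c : K) : F := phi c%:P%:P.

(** ** Genus of a function field in one variable
    The base field K is algebraically closed, so that all places have degree 1. *)
Section Genus.
Variables (K : closedFieldType) (F : fieldType) (iota : K -> F).

(* A place is represented by its normalized discrete valuation.  The value
   v 0 = +oo is replaced by the dummy value 0, and the axioms only concern
   nonzero arguments; fixing v 0 makes each place a unique function. *)
Definition is_place (v : F -> int) : Prop :=
  [/\ v 0 = 0,
      forall f g, f != 0 -> g != 0 -> v (f * g) = v f + v g,
      forall f g, f != 0 -> g != 0 -> f + g != 0 ->
        Order.min (v f) (v g) <= v (f + g),
      forall c, c != 0 -> v (iota c) = 0 &
      exists t, v t = 1].

Definition places : set (F -> int) := [set v | is_place v].

(* A divisor is given by its coefficients; only those at places matter. *)
Definition is_divisor (D : (F -> int) -> int) : Prop :=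
  finite_set (places `&` [set v | D v != 0]).

Definition div_deg (D : (F -> int) -> int) : int := \sum_(v \in places) D v.

Definition RR_space (D : (F -> int) -> int) : set F :=
  [set f | f != 0 -> forall v, places v -> 0 <= v f + D v].

Definition has_dim (V : set F) (n : nat) : Prop :=
  exists b : 'I_n -> F,
  [/\ forall i, V (b i),
      forall c : 'I_n -> K, \sum_i iota (c i) * b i = 0 -> forall i, c i = 0 &
      forall f, V f -> exists c : 'I_n -> K, f = \sum_i iota (c i) * b i].

(* genus = max over divisors D of deg D - dim L(D) + 1 *)
Definition has_genus (g : nat) : Prop :=
  (forall D n, is_divisor D -> has_dim (RR_space D) n ->
     div_deg D - n%:Z + 1 <= g%:Z) /\
  (exists D n, [/\ is_divisor D, has_dim (RR_space D) n &
     div_deg D - n%:Z + 1 = g%:Z]).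

End Genus.

Section Automorphisms.
Variables (K F : fieldType) (iota : K -> F).

Definition is_aut (s : F -> F) : Prop :=
  [/\ {morph s : f g / f + g}, {morph s : f g / f * g}, s 1 = 1,
      bijective s & forall c, s (iota c) = iota c].

Definition is_aut_subgroup (G : set (F -> F)) : Prop :=
  [/\ G `<=` [set s | is_aut s], G idfun,
      forall s t, G s -> G t -> G (s \o t) &
      forall s t, G s -> cancel s t -> cancel t s -> G t].

Definition gen_group (S : set (F -> F)) : set (F -> F) :=
  smallest is_aut_subgroup S.

End Automorphisms.

(** ** The kernel of the random walk
    The jump probabilities p_{ij} are [p i j] with [i j : int], of which only the
    values for i, j in {-1, 0, 1} are used.  In {poly {poly C}}, the outer
    variable 'X is x and 'Y := 'X%:P is y. *)
Section Kernel.
Variables (R : realType) (p : int -> int -> R).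

Definition steps : seq int := [:: -1; 0; 1].

(* x y (1 - sum_{i,j} p_ij x^i y^j), with the product by x y carried out *)
Definition kernelQ : {poly {poly R[i]}} :=
  'X * 'Y -
  \sum_(i <- steps) \sum_(j <- steps)
    ((p i j)%:C)%:P%:P * 'X ^+ absz (i + 1) * 'Y ^+ absz (j + 1).

(* a and c are the coefficients of y^2 and y^0 in - kernelQ, and at and ct
   those of x^2 and x^0. *)
Definition coef_a : {poly R[i]} :=
  (p 1 1)%:C *: 'X^2 + (p 0 1)%:C *: 'X + ((p (-1) 1)%:C)%:P.
Definition coef_c : {poly R[i]} :=
  (p 1 (-1))%:C *: 'X^2 + (p 0 (-1))%:C *: 'X + ((p (-1) (-1))%:C)%:P.
Definition coef_at : {poly R[i]} :=
  (p 1 1)%:C *: 'X^2 + (p 1 0)%:C *: 'X + ((p 1 (-1))%:C)%:P.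
Definition coef_ct : {poly R[i]} :=
  (p (-1) 1)%:C *: 'X^2 + (p (-1) 0)%:C *: 'X + ((p (-1) (-1))%:C)%:P.

Definition matP : 'M[R]_3 :=
  \matrix_(i < 3, j < 3) (p (1 - i%:Z) (1 - j%:Z)
                  - (if (i == 1) && (j == 1) then 1 else 0)).

Variables (F : fieldType) (phi : {rmorphism {poly {poly R[i]}} -> F}).

Definition gen_x : F := phi 'X.
Definition gen_y : F := phi 'Y.

Definition eval_at (f : {poly R[i]}) (z : F) : F :=
  (map_poly (const_of phi) f).[z].

Definition is_xi (xi : F -> F) : Prop :=
  [/\ is_aut (const_of phi) xi, xi gen_x = gen_x &
      xi gen_y = eval_at coef_c gen_x / (gen_y * eval_at coef_a gen_x)].

Definition is_eta (eta : F -> F) : Prop :=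
  [/\ is_aut (const_of phi) eta, eta gen_y = gen_y &
      eta gen_x = eval_at coef_ct gen_y / (gen_x * eval_at coef_at gen_y)].

End Kernel.

Definition walk_group (K F : fieldType) (phi : {rmorphism {poly {poly K}} -> F})
    (xi eta : F -> F) : set (F -> F) :=
  gen_group (const_of phi) [set s | s = xi \/ s = eta].

(* Main.v *)
Require Import Defs.
From HB Require Import structures.
From mathcomp Require Import all_boot all_order all_algebra.
From mathcomp Require Import classical_sets boolp functions cardinality fsbigop reals.
From mathcomp Require Import complex ring polyXY.

Set Implicit Arguments.
Unset Strict Implicit.
Unset Printing Implicit Defensive.

Import Order.TTheory GRing.Theory Num.Theory.
Local Open Scope classical_set_scope.
Local Open Scope complex_scope.
Local Open Scope ring_scope.

(** Write Q(x,y), up to sign, as X M Y^T with M the 3x3 matrix of the theorem,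
    X = (x^2, x, 1) and Y = (y^2, y, 1), and put x' = eta x, y' = xi y.  Both
    involutions are nontrivial and distinct, because Q is separable of degree 2
    in each variable ([conj_neq]), so the group they generate has order 4 exactly
    when they commute ([card_gen_involutions]).

    If they commute, applying 1, xi, eta and xi eta to Q(x,y) = 0 gives
    Q = 0 at the four points of {x,x'} x {y,y'}.  The rows X M and X' M are then
    both orthogonal to Y and Y', hence proportional, and a combination of the
    independent vectors X and X' is killed by M: det M = 0
    ([four_points_det0]).

    If det M = 0, a relation M v = 0 is a linear relation between the
    coefficients a(x), b(x), c(x) of Q as a polynomial in y.  Vieta's formulas
    y + y' = -b/a and y y' = c/a turn it into a relation
    v_0 - v_1 (y + y') + v_2 y y' = 0, so that y' is a homographic function of y
    with constant coefficients ([conj_mobius]) and is therefore fixed by eta.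
    The transposed argument shows that x' is fixed by xi.  Then xi eta and
    eta xi agree on x and y, hence everywhere.

    Finally, det M = 0 forces rank 2: a matrix of rank at most 1 would make Q a
    product of a nonzero polynomial in x and a nonzero polynomial in y, neither
    of which vanishes in the function field ([mxrank_gt1]). *)

(** * Biquadratic forms and points on their zero locus *)

Lemma ord3P (P : 'I_3 -> Prop) : P 0 -> P 1 -> P 2%R -> forall i, P i.
Proof.
move=> P0 P1 P2; case=> [[|[|[|//]]] i3].
- by rewrite (_ : Ordinal i3 = 0) //; apply: val_inj.
- by rewrite (_ : Ordinal i3 = 1) //; apply: val_inj.
- by rewrite (_ : Ordinal i3 = 2%R) //; apply: val_inj.
Qed.

Section Biquadratic.
Variables (R F : fieldType) (rho : {rmorphism R -> F}).
Implicit Types (u v : 'I_3 -> R) (M : 'M[R]_3) (x y : F).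

(** The coefficients are listed by decreasing degree, in the order of the rows
    and columns of the matrix of the random walk, so that index [i] goes with the
    exponent [rev_ord i = 2 - i]. *)
Definition quad u x : F := \sum_i rho (u i) * x ^+ rev_ord i.

Definition biquad M x y : F := \sum_i \sum_j rho (M i j) * x ^+ rev_ord i * y ^+ rev_ord j.

(** This holds when x is transcendental and y has degree 2 over the field of
    rational functions of x.  It also prevents x and y from being constant. *)
Definition quad_indep x y : Prop :=
  forall u v, quad u x + quad v x * y = 0 -> u =1 (fun=> 0) /\ v =1 (fun=> 0).

Lemma quadE u x : quad u x = rho (u 0) * x ^+ 2 + rho (u 1) * x + rho (u 2%R).
Proof.
rewrite /quad !big_ord_recl big_ord0 addr0 /= expr1 expr0 mulr1 addrA.
by congr (_ + rho (u _) * _ + rho (u _)); apply: val_inj.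
Qed.

Lemma quad_eq u v x : u =1 v -> quad u x = quad v x.
Proof. by move=> uv; apply: eq_bigr => i _; rewrite uv. Qed.

Lemma quad0 x : quad (fun=> 0) x = 0.
Proof. by rewrite quadE !rmorph0 !mul0r !addr0. Qed.

Lemma biquad_quad M x y : biquad M x y = \sum_j quad (M^~ j) x * y ^+ rev_ord j.
Proof.
rewrite /biquad exchange_big /=; apply: eq_bigr => j _.
by rewrite mulr_suml.
Qed.

Lemma biquadE M x y : biquad M x y =
  quad (M^~ 0) x * y ^+ 2 + quad (M^~ 1) x * y + quad (M^~ 2%R) x.
Proof.
rewrite biquad_quad !big_ord_recl big_ord0 addr0 /= expr1 expr0 mulr1 addrA.
by congr (_ + quad _ _ * _ + quad _ _); apply/funext => k; congr (M _ _); apply: val_inj.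
Qed.

Lemma biquad_tr M x y : biquad M^T y x = biquad M x y.
Proof.
rewrite /biquad exchange_big; apply: eq_bigr => i _; apply: eq_bigr => j _.
by rewrite mxE mulrAC.
Qed.

Lemma morph_quad (s : {rmorphism F -> F}) u x :
  (forall r, s (rho r) = rho r) -> s (quad u x) = quad u (s x).
Proof.
by move=> sr; rewrite rmorph_sum; apply: eq_bigr => i _; rewrite rmorphM rmorphXn sr.
Qed.

Lemma morph_biquad (s : {rmorphism F -> F}) M x y :
  (forall r, s (rho r) = rho r) -> s (biquad M x y) = biquad M (s x) (s y).
Proof.
move=> sr; rewrite !biquad_quad rmorph_sum; apply: eq_bigr => j _.
by rewrite rmorphM rmorphXn morph_quad.
Qed.

Lemma quad_vieta (a b c y y' : F) : y != y' ->
  a * y ^+ 2 + b * y + c = 0 -> a * y' ^+ 2 + b * y' + c = 0 ->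
  b = - a * (y + y') /\ c = a * y * y'.
Proof.
rewrite -subr_eq0 => yy' e e'.
have bE : b = - a * (y + y').
  apply/eqP; rewrite -subr_eq0 -(mulIr_eq0 _ (mulIf yy')); apply/eqP.
  have -> : (b - - a * (y + y')) * (y - y') =
    (a * y ^+ 2 + b * y + c) - (a * y' ^+ 2 + b * y' + c) by ring.
  by rewrite e e' subr0.
split=> //; apply/eqP; rewrite -subr_eq0; apply/eqP; rewrite -[RHS]e bE; ring.
Qed.

Lemma row_quad M x j :
  ((\row_i x ^+ rev_ord i) *m map_mx rho M) 0 j = quad (M^~ j) x.
Proof. by rewrite mxE; apply: eq_bigr => i _; rewrite !mxE mulrC. Qed.

(** With X = (x^2, x, 1), the rows X M and X' M hold the coefficients of two
    quadratic polynomials having the same two roots y, y'.  By Vieta's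
    formulas they are a1 and a2 times one and the same row, a1 and a2 being the
    leading coefficients, so M kills a2 X - a1 X', or X itself when a1 = 0. *)
Lemma four_points_det0 M x x' y y' : x != x' -> y != y' ->
  biquad M x y = 0 -> biquad M x y' = 0 ->
  biquad M x' y = 0 -> biquad M x' y' = 0 -> \det M = 0.
Proof.
move=> xx' yy'; rewrite !biquadE => e1 e2 e3 e4.
have [b1 c1] := quad_vieta yy' e1 e2.
have [b2 c2] := quad_vieta yy' e3 e4.
pose X z : 'rV[F]_3 := \row_i z ^+ rev_ord i.
suff /eqP : \det (map_mx rho M) = 0 by rewrite det_map_mx fmorph_eq0 => /eqP.
have row0 (w : 'rV[F]_3) : w 0 0 = 0 -> w 0 1 = 0 -> w 0 2%R = 0 -> w = 0.
  by move=> w0 w1 w2; apply/rowP; apply: ord3P; rewrite [RHS]mxE.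
apply/eqP; apply/det0P.
set a1 := quad (M^~ 0) x in b1 c1; set a2 := quad (M^~ 0) x' in b2 c2.
have [a10|a1n0] := eqVneq a1 0.
  exists (X x).
    apply/eqP => /rowP /(_ 2%R) /eqP.
    by rewrite !mxE /= expr0 oner_eq0.
  by apply: row0; rewrite row_quad -/a1 ?b1 ?c1 a10 ?oppr0 ?mul0r ?mul0r.
exists (a2 *: X x - a1 *: X x').
  (* The last coordinate gives a1 = a2, and the middle one then x = x'. *)
  apply/eqP => /rowP X0; have := X0 1; have := X0 2%R.
  rewrite !mxE /= expr0 !expr1 !mulr1 => /eqP; rewrite subr_eq0 => /eqP ->.
  by move/eqP; rewrite -mulrBr mulf_eq0 (negPf a1n0) subr_eq0 (negPf xx').
apply: row0; rewrite mulmxBl -!scalemxAl [LHS]mxE [X in _ + X]mxE [X in X + _]mxE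
  [X in _ - X]mxE !row_quad ?b1 ?c1 ?b2 ?c2 -/a1 -/a2; ring.
Qed.

(** ** A generic point of the curve and its conjugate *)

Section Curve.
Variables (M : 'M[R]_3) (x y : F).
Hypotheses (indep : quad_indep x y) (M0 : M != 0) (Mxy : biquad M x y = 0).

Lemma quad_neq0 u : ~ u =1 (fun=> 0) -> quad u x != 0.
Proof.
move=> u0; apply/eqP => e; apply: u0.
by have [] := @indep u (fun=> 0); rewrite // quad0 mul0r addr0.
Qed.

Lemma gen_neq0 : y != 0.
Proof.
apply/eqP => y0.
have /indep[_ /(_ 0) /eqP] : quad (fun=> 0) x + quad (fun=> 1) x * y = 0.
  by rewrite y0 mulr0 addr0 quad0.
by rewrite oner_eq0.
Qed.

(** If the coefficient a(x) of y^2 vanished, b(x) y + c(x) = 0 would make b and c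
    zero by independence; a would be zero as well, hence M. *)
Lemma lead_neq0 : quad (M^~ 0) x != 0.
Proof.
apply/eqP => a0; have /indep[c0 b0] : quad (M^~ 2%R) x + quad (M^~ 1) x * y = 0.
  rewrite -[RHS]Mxy biquadE a0; ring.
have /indep[{}a0 _] : quad (M^~ 0) x + quad (fun=> 0) x * y = 0.
  by rewrite a0 quad0 mul0r addr0.
by move/eqP: M0; apply; apply/matrixP => i; apply: ord3P; rewrite mxE.
Qed.

Lemma conj_prod (y' : F) :
  y' = quad (M^~ 2%R) x / (y * quad (M^~ 0) x) ->
  quad (M^~ 2%R) x = quad (M^~ 0) x * y * y'.
Proof.
by move=> ->; rewrite mulrC [y * _]mulrC divfK ?mulf_neq0 ?lead_neq0 ?gen_neq0.
Qed.

(** A double root y would satisfy the linear equation b(x) + 2 a(x) y = 0. *)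
Lemma conj_neq (y' : F) : (2 : R) != 0 ->
  y' = quad (M^~ 2%R) x / (y * quad (M^~ 0) x) -> y' != y.
Proof.
move=> two0 /conj_prod y'E; apply/eqP => y'y; subst y'.
have /indep[_ a0] : quad (M^~ 1) x + quad (fun i => 2 * M i 0) x * y = 0.
  apply: (mulIf gen_neq0); rewrite mul0r -[RHS]Mxy biquadE y'E.
  rewrite !quadE !rmorphM !rmorph_nat; ring.
move: lead_neq0; rewrite (@quad_eq _ (fun=> 0)) ?quad0 ?eqxx // => i.
by apply/eqP; have /eqP := a0 i; rewrite mulf_eq0 (negPf two0).
Qed.

(** The relation M v = 0 reads v_0 a(x) + v_1 b(x) + v_2 c(x) = 0.  Substituting
    b = - a (y + y') and c = a y y' and dividing by a leaves
    v_0 - v_1 (y + y') + v_2 y y' = 0, which is solved for y'. *)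
Lemma conj_mobius (y' : F) (v : 'cV[R]_3) : v != 0 -> M *m v = 0 ->
  y' = quad (M^~ 2%R) x / (y * quad (M^~ 0) x) ->
  y' = (rho (v 1 0) * y - rho (v 0 0)) / (rho (v 2%R 0) * y - rho (v 1 0)).
Proof.
move=> v0 Mv /conj_prod y'E; have a0 := lead_neq0.
have dep : rho (v 0 0) * quad (M^~ 0) x + rho (v 1 0) * quad (M^~ 1) x +
           rho (v 2%R 0) * quad (M^~ 2%R) x = 0.
  have : \sum_j quad (M^~ j) x * rho (v j 0) = 0.
    under eq_bigr do rewrite mulr_suml.
    rewrite exchange_big big1 //= => i _.
    have := congr1 (fun u : 'cV_3 => rho (u i 0) * x ^+ rev_ord i) Mv.
    rewrite !mxE rmorph0 mul0r rmorph_sum mulr_suml => e; rewrite -[RHS]e.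
    by apply: eq_bigr => j _; rewrite rmorphM; ring.
  move=> e; rewrite -[RHS]e !big_ord_recl big_ord0 addr0 addrA.
  by rewrite ![rho _ * _]mulrC; congr (_ + quad _ _ * rho _ + quad _ _ * rho _);
    do ?apply/funext => k; congr (fun_of_matrix _ _ _); apply: val_inj.
have bE : quad (M^~ 1) x = - quad (M^~ 0) x * (y + y').
  apply/eqP; rewrite -subr_eq0; apply/eqP/(mulIf gen_neq0).
  rewrite mul0r -[RHS]Mxy biquadE y'E; ring.
have {}dep : rho (v 0 0) - rho (v 1 0) * (y + y') + rho (v 2%R 0) * y * y' = 0.
  by apply: (mulfI a0); rewrite mulr0 -[RHS]dep bE y'E; ring.
(* Since y is not a constant, v_2 y = v_1 forces v_2 = v_1 = 0, and then v_0 = 0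
   by the relation above. *)
have den0 : rho (v 2%R 0) * y - rho (v 1 0) != 0.
  apply/eqP => den0; move/eqP: v0; apply.
  pose c2 r (i : 'I_3) : R := if i == 2%R then r else 0.
  have qc2 r : quad (c2 r) x = rho r by rewrite quadE /c2 /= !rmorph0 !mul0r !add0r.
  have /indep[/(_ 2%R)] : quad (c2 (- v 1 0)) x + quad (c2 (v 2%R 0)) x * y = 0.
    by rewrite !qc2 rmorphN -[RHS]den0; ring.
  rewrite /c2 /= => /eqP; rewrite oppr_eq0 => /eqP v1 /(_ 2%R) /= v2.
  have v00 : v 0 0 = 0.
    apply/eqP; rewrite -(fmorph_eq0 rho); apply/eqP; rewrite -[RHS]dep v1 v2 rmorph0.
    ring.
  by apply/colP; apply: ord3P; rewrite [RHS]mxE.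
apply: (mulIf den0); rewrite divfK //; apply/eqP; rewrite -subr_eq0.
by apply/eqP; rewrite -[RHS]dep; ring.
Qed.

End Curve.

(** A factorization of M through a space of dimension at most 1 splits the
    biquadratic form into u(x) v(y), and neither factor can vanish. *)
Lemma mxrank_gt1 M x y : quad_indep x y -> quad_indep y x -> M != 0 ->
  biquad M x y = 0 -> (1 < \rank M)%N.
Proof.
move=> indep indep' M0 Mxy; rewrite ltnNge; apply/negP; move: (mulmx_base M).
move: (col_base M) (row_base M); case: (\rank M) => [|[|//]] U V UV _.
  by move/eqP: M0; apply; rewrite -UV thinmx0 mul0mx.
have Mij i j : M i j = U i 0 * V 0 j by rewrite -UV mxE big_ord1.
have : quad (U^~ 0) x * quad (V 0) y = 0.
  rewrite -[RHS]Mxy /biquad mulr_suml; apply: eq_bigr => i _.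
  rewrite mulr_sumr; apply: eq_bigr => j _; rewrite Mij rmorphM; ring.
have M0' : ~ forall i j, U i 0 * V 0 j = 0.
  by move=> UV0; move/eqP: M0; apply; apply/matrixP => i j; rewrite Mij UV0 mxE.
apply/eqP; rewrite mulf_neq0 ?(quad_neq0 indep) ?(quad_neq0 indep') //.
  by move=> U0; apply: M0' => i j; rewrite U0 mul0r.
by move=> V0; apply: M0' => i j; rewrite V0 mulr0.
Qed.
End Biquadratic.

(** * Groups of order 4 generated by two involutions *)

Lemma card_uniq_seq (T : eqType) (s : seq T) :
  uniq s -> ([set x | x \in s] #= `I_(size s))%card.
Proof.
case: s => [|x0 s] us.
  by rewrite (_ : [set x | x \in [::]] = set0) ?II0 // predeqE => x; split.
rewrite (_ : [set x | _] = nth x0 (x0 :: s) @` `I_(size (x0 :: s))).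
  apply: inj_card_eq => i j; rewrite !inE => Hi Hj /eqP.
  by rewrite nth_uniq // => /eqP.
rewrite predeqE => x; split => [/(nthP x0)[i Hi <-]|[i Hi <-]]; first by exists i.
exact: mem_nth.
Qed.

Lemma card_set4P (T : eqType) (A : set T) (a b c d : T) :
  A a -> A b -> A c -> A d ->
  a <> b -> a <> c -> a <> d -> b <> c -> b <> d -> c <> d ->
  (A #= `I_4)%card <-> (forall z, A z -> [\/ z = a, z = b, z = c | z = d]).
Proof.
move=> Aa Ab Ac Ad /eqP ab /eqP ac /eqP ad /eqP bc /eqP bd /eqP cd.
have uV : uniq [:: a; b; c; d] by rewrite /= !inE !negb_or ab ac ad bc bd cd.
split=> [A4 z Az|AV].
  have [zV|zV] := boolP (z \in [:: a; b; c; d]).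
    move: zV; rewrite !inE => /or4P[] /eqP ->;
      by [constructor 1|constructor 2|constructor 3|constructor 4].
  have u5 : uniq (z :: [:: a; b; c; d]) by rewrite cons_uniq zV.
  have sub : [set r | r \in z :: [:: a; b; c; d]] `<=` A.
    by move=> r /=; rewrite !inE => /orP[|/or4P[]] /eqP ->.
  have := subset_card_le sub.
  by rewrite (card_le_eqr A4) (card_le_eql (card_uniq_seq u5)) card_le_II.
rewrite (_ : A = [set r | r \in [:: a; b; c; d]]); first exact: card_uniq_seq.
apply/seteqP; split=> r /=; rewrite !inE.
  by case/AV => ->; rewrite eqxx ?orbT.
by case/or4P => /eqP ->.
Qed.

Section AutGroup.
Variables (K F : fieldType) (iota : K -> F).
Implicit Types s t : F -> F.

Lemma is_aut_rmorphism s : is_aut iota s -> exists s' : {rmorphism F -> F}, s = s'.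
Proof.
case=> sD sM s1 _ _.
have s0 : s 0 = 0 by apply: (addrI (s 0)); rewrite -sD !addr0.
have sN x : s (- x) = - s x by apply/eqP; rewrite -addr_eq0 -sD addNr s0.
have sB : zmod_morphism s by move=> x y; rewrite sD sN.
have sMon : monoid_morphism s by split.
pose s' : {rmorphism F -> F} := HB.pack s (GRing.isZmodMorphism.Build F F s sB)
   (GRing.isMonoidMorphism.Build F F s sMon).
by exists s'.
Qed.

Lemma is_aut_comp s t : is_aut iota s -> is_aut iota t -> is_aut iota (s \o t).
Proof.
move=> [sD sM s1 sb sc] [tD tM t1 tb tc]; split=> /=.
- by move=> x y /=; rewrite tD sD.
- by move=> x y /=; rewrite tM sM.
- by rewrite t1 s1.
- exact: bij_comp.
- by move=> c; rewrite tc sc.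
Qed.

Lemma is_aut_id : is_aut iota idfun.
Proof. by split=> //; exists id. Qed.

Lemma gen_group_aut_subgroup (S : set (F -> F)) : S `<=` [set s | is_aut iota s] ->
  is_aut_subgroup iota (gen_group iota S).
Proof.
move=> Saut; split.
- apply: smallest_sub => //; split=> //.
  + exact: is_aut_comp.
  + move=> s t [sD sM s1 _ sc] st ts; split.
    * by move=> x y; apply: (can_inj st); rewrite sD !ts.
    * by move=> x y; apply: (can_inj st); rewrite sM !ts.
    * by rewrite -s1 st.
    * by exists s.
    * by move=> c; rewrite -{1}(sc c) st.
- by move=> G [[]].
- by move=> s t Gs Gt G GS; have [[_ _ Gc _] _] := GS; apply: Gc; [apply: Gs|apply: Gt].
- by move=> s t Gs st ts G GS; have [[_ _ _ Gi] _] := GS; apply: (Gi s) => //; apply: Gs.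
Qed.

(** The elements id, s, t and s t are always distinct.  If the order is 4, then
    t s is one of them, and it can only be s t.  Conversely, if s and t commute,
    these four elements already form a group. *)
Lemma card_gen_involutions s t :
  is_aut iota s -> is_aut iota t -> involutive s -> involutive t ->
  s <> id -> t <> id -> s <> t ->
  (gen_group iota [set r | r = s \/ r = t] #= `I_4)%card <-> s \o t = t \o s.
Proof.
move=> sA tA ss tt s1 t1 st.
set S := [set r | _]; have SA : S `<=` [set r | is_aut iota r].
  by move=> r [] ->.
have [_ G1 Gc _] := gen_group_aut_subgroup SA.
have Gs : gen_group iota S s by apply: sub_gen_smallest; left.
have Gt : gen_group iota S t by apply: sub_gen_smallest; right.
have ssK : s \o s = id by apply/funext => x /=.
have ttK : t \o t = id by apply/funext => x /=.
have st1 : s \o t <> id.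
  by move=> /(congr1 (comp s)); rewrite compA ssK => /esym.
have sts : s \o t <> s.
  by move=> /(congr1 (comp s)); rewrite compA ssK.
have stt : s \o t <> t.
  by move=> /(congr1 (comp^~ t)) /=; rewrite -compA ttK.
have G4P : (gen_group iota S #= `I_4)%card <->
    forall z, gen_group iota S z -> [\/ z = id, z = s, z = t | z = s \o t].
  by apply: card_set4P => //; first [exact: Gc | move=> /esym].
apply: (iff_trans G4P).
split=> [/(_ (t \o s)) V|stC].
  case: V => [|ts1|tss|tst|//]; first exact: Gc.
  - by case: st; rewrite -[RHS]/(t \o id) -ts1 compA ttK.
  - by case: t1; rewrite -[LHS]/(t \o id) -ssK compA tss.
  - by case: s1; rewrite -[LHS]/(id \o s) -ttK -compA tst.
have sx x : s (t x) = t (s x) by have := congr1 (@^~ x) stC.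
pose V := [set r : F -> F | [\/ r = id, r = s, r = t | r = s \o t]].
suff VG : is_aut_subgroup iota V.
  move=> z; apply: (smallest_sub VG) => r [] ->; [constructor 2|constructor 3]; by [].
have Vinv (r : F -> F) : V r -> r \o r = id.
  by case=> ->; apply/funext => x; rewrite /= ?sx ?tt ?ss.
split.
- by move=> r [] -> //=; [exact: is_aut_id|exact: is_aut_comp].
- by constructor 1.
- move=> r q Hr Hq; rewrite /V /=.
    case: Hr => ->; case: Hq => ->;
      [> constructor 1|constructor 2|constructor 3|constructor 4
       | constructor 2|constructor 1|constructor 4|constructor 3
       | constructor 3|constructor 4|constructor 1|constructor 2
       | constructor 4|constructor 3|constructor 2|constructor 1];
      by apply/funext => x /=; rewrite ?sx ?ss ?tt ?sx ?ss ?tt.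
- move=> r q Vr rq qr; suff -> : q = r by [].
  have /(congr1 (comp q)) := Vinv _ Vr.
  by rewrite compA (_ : q \o r = id) //; apply/funext => x /=.
Qed.
End AutGroup.

(** * The function field of a curve of bidegree (2, 2) *)

(** Degrees add up in an integral domain.  With h the equation of the curve,
    regarded as a polynomial in x or in y, this says that no nonzero polynomial of
    degree at most 1 in one of the variables vanishes on the curve. *)
Lemma small_multiple_eq0 (A : idomainType) (g h : {poly A}) n :
  size h = n.+1 -> (size (g * h)%R <= n)%N -> g * h = 0.
Proof.
move=> hn; have [->|g0] := eqVneq g 0; first by rewrite mul0r.
have h0 : h != 0 by rewrite -size_poly_eq0 hn.
by rewrite size_mul // hn addnS /= leqNgt -[X in (X < _)%N]add0n ltn_add2r size_poly_gt0 g0.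
Qed.

Section FunctionField.
Variables (R K F : fieldType) (j : {rmorphism R -> K}).
Variables (q : {poly {poly K}}) (phi : {rmorphism {poly {poly K}} -> F}).
Hypothesis F_ff : is_function_field q phi.

Lemma rmorph_gen_eq (s t : {rmorphism F -> F}) :
  (forall c, s (const_of phi c) = t (const_of phi c)) ->
  s (phi 'X) = t (phi 'X) -> s (phi 'Y) = t (phi 'Y) -> s =1 t.
Proof.
move=> stc stx sty.
have stP (f : {poly K}) : s (phi f%:P) = t (phi f%:P).
  elim/poly_ind: f => [|f c IH]; first by rewrite !rmorph0.
  by rewrite polyCD polyCM !rmorphD !rmorphM /= IH sty [X in _ + X]stc.
have st f : s (phi f) = t (phi f).
  elim/poly_ind: f => [|f c IH]; first by rewrite !rmorph0.
  by rewrite !rmorphD !rmorphM /= IH stx stP.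
by move=> z; have [_ /(_ z)[f [g [_ ->]]]] := F_ff; rewrite !fmorph_div !st.
Qed.

Let rho : {rmorphism R -> F} := phi \o polyC \o polyC \o j.

Definition quadp (u : 'I_3 -> R) : {poly K} :=
  j (u 0) *: 'X^2 + j (u 1) *: 'X + (j (u 2%R))%:P.

Lemma quadp_eq0 u : quadp u = 0 -> u =1 (fun=> 0).
Proof.
move=> u0 i; apply/eqP; rewrite -(fmorph_eq0 j); apply/eqP.
suff <- : (quadp u)`_(rev_ord i) = j (u i) by rewrite u0 coef0.
rewrite /quadp; case: i => [[|[|[|//]]] i3]; rewrite !coefD !coefZ coefC coefXn coefX /=;
  rewrite ?mulr0 ?mulr1 ?addr0 ?add0r; congr (j (u _)); exact: val_inj.
Qed.

Let lin u v : {poly {poly K}} := (quadp u)%:P + (quadp v)%:P * 'X.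

Lemma phi_quadp u : phi (quadp u)%:P = quad rho u (phi 'Y).
Proof.
by rewrite quadE /quadp !polyCD -!mul_polyC expr2 !polyCM !rmorphD !rmorphM expr2.
Qed.

Lemma phi_quadpX u : phi (quadp u)^:P = quad rho u (phi 'X).
Proof.
by rewrite quadE /quadp !rmorphD /= -!mul_polyC expr2 !rmorphM /= !map_polyC !map_polyX.
Qed.

Lemma linear_eq0 u v : lin u v = 0 -> u =1 (fun=> 0) /\ v =1 (fun=> 0).
Proof.
move=> luv; split; apply: quadp_eq0.
  by have := congr1 (fun f : {poly _} => f`_0) luv; rewrite coef0 coefD coefMX coefC addr0.
by have := congr1 (fun f : {poly _} => f`_1) luv;
  rewrite coef0 coefD coefMX !coefC add0r.
Qed.

Lemma size_linear u v : (size (lin u v) <= 2)%N.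
Proof.
rewrite (leq_trans (size_polyD _ _)) // geq_max (leq_trans (size_polyC_leq1 _)) //=.
by rewrite (leq_trans (size_polyMleq _ _)) // size_polyX addn2 /= ltnS size_polyC_leq1.
Qed.

Lemma gen_indepX : size q = 3%N -> quad_indep rho (phi 'Y) (phi 'X).
Proof.
move=> qn u v; rewrite -!phi_quadp -rmorphM -rmorphD => /F_ff.1[g lg].
by apply: linear_eq0; rewrite /lin lg (@small_multiple_eq0 _ _ _ 2) // -lg size_linear.
Qed.

(** Exchanging the variables reduces this to a bound on the degree in the outer
    variable, as in [gen_indepX]. *)
Lemma gen_indepY : sizeY q = 3%N -> quad_indep rho (phi 'X) (phi 'Y).
Proof.
rewrite sizeYE => qn u v; rewrite -!phi_quadpX -rmorphM -rmorphD => /F_ff.1[g lg].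
have {}lg : lin u v = swapXY g * swapXY q.
  by rewrite -rmorphM -lg rmorphD rmorphM /= !swapXY_map_polyC swapXY_Y.
by apply: linear_eq0; rewrite lg (@small_multiple_eq0 _ _ _ 2) // -lg size_linear.
Qed.

End FunctionField.

Section Involution.
Variables (K F : fieldType) (q : {poly {poly K}}).
Variables (phi : {rmorphism {poly {poly K}} -> F}).
Hypothesis F_ff : is_function_field q phi.

(** Applying s to y (s y) = c/a, whose right-hand side it fixes, gives
    s (s y) = y.  The disjunction lets the lemma serve for both generators of the
    walk group. *)
Lemma fixing_swap_involutive (s : {rmorphism F -> F}) (a c : F) (x y : F) :
  (forall c, s (const_of phi c) = const_of phi c) ->
  (x = phi 'X /\ y = phi 'Y) \/ (x = phi 'Y /\ y = phi 'X) ->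
  s x = x -> s a = a -> s c = c -> y != 0 -> c != 0 ->
  s y = c / (y * a) -> involutive s.
Proof.
move=> sK xy sx sa sc y0 c0 sy.
have sy0 : s y != 0 by rewrite fmorph_eq0.
have a0 : a != 0 by apply: contraNneq sy0 => a0; rewrite sy a0 mulr0 invr0 mulr0.
have ssy : s (s y) = y.
  by rewrite {1}sy fmorph_div rmorphM sc sa sy; field; rewrite c0 y0 a0.
move=> z; pose ss : {rmorphism F -> F} := s \o s.
apply: (rmorph_gen_eq F_ff (s := ss) (t := idfun)) => [b||] /=; first by rewrite !sK.
  by case: xy => -[? ?]; subst; rewrite ?ssy // !sx.
by case: xy => -[? ?]; subst; rewrite ?ssy // !sx.
Qed.
End Involution.

(** * The kernel of the random walk *)

Lemma kernelQE (R : realType) (p : int -> int -> R) : kernelQ p =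
  - \sum_i \sum_j (matP p i j)%:C%:P%:P * 'X ^+ rev_ord i * 'Y ^+ rev_ord j.
Proof.
have e0 : absz (-1 + 1) = 0%N by [].
have e1 : absz (0 + 1) = 1%N by [].
have e2 : absz (1 + 1) = 2%N by [].
have r0 : rev_ord (ord0 : 'I_3) = 2%N :> nat by [].
have r1 : rev_ord (lift ord0 ord0 : 'I_3) = 1%N :> nat by [].
have r2 : rev_ord (lift ord0 (lift ord0 ord0) : 'I_3) = 0%N :> nat by [].
rewrite /kernelQ /steps !big_cons !big_nil !big_ord_recl !big_ord0.
rewrite e0 e1 e2 r0 r1 r2 !mxE /=.
rewrite !subr0 (_ : 1 - 1%N%:Z = 0) // (_ : 1 - 2%N%:Z = -1) //.
rewrite !rmorphB !rmorph1; ring.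
Qed.

Theorem proposition2p7 (R : realType) (p : int -> int -> R)
  (p_ge0 : forall i j : int, i \in steps -> j \in steps -> 0 <= p i j)
  (p_sum1 : \sum_(i <- steps) \sum_(j <- steps) p i j = 1)
  (Q_irr : irreducible_elt (kernelQ p))
  (Q_degx : size (kernelQ p) = 3%N)
  (Q_degy : sizeY (kernelQ p) = 3%N)
  (F : fieldType) (phi : {rmorphism {poly {poly R[i]}} -> F})
  (F_ff : is_function_field (kernelQ p) phi)
  (Q_genus1 : has_genus (const_of phi) 1)
  (xi eta : F -> F) (Hxi : is_xi p phi xi) (Heta : is_eta p phi eta) :
  ((walk_group phi xi eta #= `I_4)%card <-> \det (matP p) = 0) /\
  (\rank (matP p) = 2%N <-> (walk_group phi xi eta #= `I_4)%card).
Proof.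
have indX := gen_indepX (j := real_complex R) F_ff Q_degx.
have indY := gen_indepY (j := real_complex R) F_ff Q_degy.
case: Hxi Heta => xiA xix xiy [etaA etay etax].
have [_ _ _ _ xic] := xiA; have [_ _ _ _ etac] := etaA.
have [xi' xiE] := is_aut_rmorphism xiA.
have [eta' etaE] := is_aut_rmorphism etaA.
subst xi eta; rename xi' into xi; rename eta' into eta.
set M := matP p; set x := gen_x phi; set y := gen_y phi.
rewrite -/x -/y in indX indY xix xiy etax etay.
set rho : {rmorphism R -> F} := phi \o polyC \o polyC \o real_complex R in indX indY.
have Mxy : biquad rho M x y = 0.
  have : phi (kernelQ p) = 0 by apply/F_ff.1; exists 1; rewrite mul1r.
  rewrite kernelQE rmorphN => /eqP; rewrite oppr_eq0 => /eqP e; rewrite -[RHS]e.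
  rewrite rmorph_sum; apply: eq_bigr => i _; rewrite rmorph_sum.
  by apply: eq_bigr => j _; rewrite !rmorphM !rmorphXn.
have M0 : M != 0.
  apply/eqP => M0; move: Q_degx; rewrite kernelQE -/M M0 big1 ?oppr0 ?size_poly0 //.
  by move=> i _; rewrite big1 // => j _; rewrite mxE !rmorph0 !mul0r.
have Mtyx : biquad rho M^T y x = 0 by rewrite biquad_tr.
have Mt0 : M^T != 0 by rewrite -trmx0 (inj_eq trmx_inj).
have evE a b c (z : F) : eval_at phi (a%:C *: 'X^2 + b%:C *: 'X + (c%:C)%:P) z =
   rho a * z ^+ 2 + rho b * z + rho c.
  pose k : {rmorphism R[i] -> F} := phi \o polyC \o polyC.
  rewrite /eval_at -[map_poly _ _]/(map_poly k _).
  by rewrite !rmorphD /= !map_polyZ map_polyXn map_polyX map_polyC !hornerE.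
(* The polynomials a, c and their analogues in y are read off the outer columns
   of M and of its transpose, which the entry p_00 - 1 does not meet. *)
have aE : eval_at phi (coef_a p) x = quad rho (M^~ 0) x.
  by rewrite evE quadE !mxE /= !subr0.
have cE : eval_at phi (coef_c p) x = quad rho (M^~ 2%R) x.
  by rewrite evE quadE !mxE /= !subr0.
have atE : eval_at phi (coef_at p) y = quad rho (M^T^~ 0) y.
  by rewrite evE quadE !mxE /= !subr0.
have ctE : eval_at phi (coef_ct p) y = quad rho (M^T^~ 2%R) y.
  by rewrite evE quadE !mxE /= !subr0.
rewrite aE cE in xiy; rewrite atE ctE in etax.
have two0 : (2 : R) != 0 by rewrite pnatr_eq0.
have xirho r : xi (rho r) = rho r by exact: xic.
have etarho r : eta (rho r) = rho r by exact: etac.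
have x0 : x != 0 by exact: (gen_neq0 indX).
have y0 : y != 0 by exact: (gen_neq0 indY).
have xiyy := conj_neq indY M0 Mxy two0 xiy.
have etaxx := conj_neq indX Mt0 Mtyx two0 etax.
have xixi : involutive xi.
  apply: (fixing_swap_involutive F_ff xic _ xix _ _ y0 _ xiy) => //.
  - by left.
  - by rewrite morph_quad // xix.
  - by rewrite morph_quad // xix.
  - by apply: contraTneq (y0) => c0; rewrite -(fmorph_eq0 xi) xiy c0 mul0r eqxx.
have etaeta : involutive eta.
  apply: (fixing_swap_involutive F_ff etac _ etay _ _ x0 _ etax) => //.
  - by right.
  - by rewrite morph_quad // etay.
  - by rewrite morph_quad // etay.
  - by apply: contraTneq (x0) => c0; rewrite -(fmorph_eq0 eta) etax c0 mul0r eqxx.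
have card4 : (walk_group phi xi eta #= `I_4)%card <-> \det M = 0.
  apply: (iff_trans (card_gen_involutions xiA etaA xixi etaeta _ _ _)).
  - by move=> /(congr1 (@^~ y)) /eqP; rewrite (negPf xiyy).
  - by move=> /(congr1 (@^~ x)) /eqP; rewrite (negPf etaxx).
  - by move=> /(congr1 (@^~ y)) /eqP; rewrite etay (negPf xiyy).
  split=> [comm|/eqP detM].
    (* The curve passes through the four points of {x, eta x} x {y, xi y}. *)
    apply: (four_points_det0 (rho := rho) (x := x) (x' := eta x) (y := y) (y' := xi y)) => //.
    - by rewrite eq_sym.
    - by rewrite eq_sym.
    - by rewrite -{1}xix -morph_biquad // Mxy rmorph0.
    - by rewrite -{1}etay -morph_biquad // Mxy rmorph0.
    - have etax_fix : xi (eta x) = eta x.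
        by have := congr1 (@^~ x) comm; rewrite /= xix.
      rewrite -{1}etax_fix -morph_biquad // -{1}etay -morph_biquad //.
      by rewrite Mxy !rmorph0.
  have [v v0 vM] : exists2 v : 'cV[R]_3, v != 0 & M *m v = 0.
    move: detM; rewrite -det_tr => /det0P[v v0 vM]; exists v^T.
      by rewrite -trmx0 (inj_eq trmx_inj).
    by apply: trmx_inj; rewrite trmx_mul trmxK vM trmx0.
  have [w w0 wM] : exists2 w : 'cV[R]_3, w != 0 & M^T *m w = 0.
    move: detM => /det0P[w w0 wM]; exists w^T.
      by rewrite -trmx0 (inj_eq trmx_inj).
    by rewrite -trmx_mul wM trmx0.
  have xiyE := conj_mobius indY M0 Mxy v0 vM xiy.
  have etaxE := conj_mobius indX Mt0 Mtyx w0 wM etax.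
  (* By these formulas, xi y is a function of y alone, so eta fixes it; likewise
     xi fixes eta x. *)
  apply/funext; pose s : {rmorphism F -> F} := xi \o eta.
  pose t : {rmorphism F -> F} := eta \o xi.
  apply: (rmorph_gen_eq F_ff (s := s) (t := t)) => [b||] /=.
  - by rewrite xic etac xic.
  - by rewrite -/(gen_x phi) -/x xix etaxE fmorph_div !rmorphB !rmorphM !xirho xix.
  - by rewrite -/(gen_y phi) -/y etay xiyE fmorph_div !rmorphB !rmorphM !etarho etay.
split=> //; apply: (iff_trans _ (iff_sym card4)).
have rM : (1 < \rank M)%N := mxrank_gt1 indY indX M0 Mxy.
have detE : (\det M == 0) = (\rank M != 3)%N.
  by rewrite -[LHS]negbK -unitfE -unitmxE -row_free_unit.
split=> [r2|/eqP]; first by apply/eqP; rewrite detE r2.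
rewrite detE => r3; apply/eqP; rewrite eqn_leq rM andbT -ltnS ltn_neqAle r3.
exact: rank_leq_row.
Qed.
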